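(* Let $m$ be a positive integer, suppose that the index set $T$ is a compact subset of $\mathbb{R}^m$, and let $T_o\subseteq\mathbb{R}^m$ be an open set that includes $T$. Let $f_{T_o}\colon\mathbb{R}\times T_o\to\mathbb{R}$ be a Borel measurable map with $f_t=f_{T_o}(\cdot,t)$ for every $t\in T$. Assume that $f_{T_o}$ is continuously differentiable in both arguments $(x,t)$ on all of $\mathbb{R}\times T_o$, and that $\mathrm{E}^P\big(\sup_{t\in T}|f_t|\big)<+\infty$. Then $\hat{\underline{\mathrm{E}}}_n(f)$ is a strongly consistent estimator of $\underline{\mathrm{E}}^{\mathscr{P}}(f)$.
   Context: Setting. $\mathscr{B}$ is the Borel $\sigma$-field on $\mathbb{R}$. $T$ is a non-empty index set, $\mathscr{P}=\{P_t : t\in T\}$ is a set of probability measures on $(\mathbb{R},\mathscr{B})$, and $P$ is a probability measure on $(\mathbb{R},\mathscr{B})$, not necessarily in $\mathscr{P}$. For a probability measure $Q$, $\mathrm{E}^Q(h)=\int h\,\mathrm{d}Q$. The map $f\colon\mathbb{R}\to\mathbb{R}$ is Borel measurable with $\sup_{t\in T}\mathrm{E}^{P_t}(|f|)<+\infty$, and $\underline{\mathrm{E}}^{\mathscr{P}}(f):=\inf_{t\in T}\mathrm{E}^{P_t}(f)$. For each $t\in T$, $f_t\colon\mathbb{R}\to\mathbb{R}$ is a Borel measurable map with $\mathrm{E}^P(f_t)=\mathrm{E}^{P_t}(f)$ and $\mathrm{E}^P(|f_t|)=\mathrm{E}^{P_t}(|f|)$ (so each $f_t$ is $P$-integrable).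 $\sup_{t\in T}|f_t|$ is the pointwise supremum. Sampling. $(\mathbb{R}^\infty,\mathscr{B}^\infty,P^\infty)$ is the countably infinite product of copies of $(\mathbb{R},\mathscr{B},P)$ and $X_k\colon\mathbb{R}^\infty\to\mathbb{R}$ is the $k$-th coordinate projection. The estimator is the extended real-valued map $\hat{\underline{\mathrm{E}}}_n(f):=\inf_{t\in T}\frac1n\sum_{k=1}^n f_t(X_k)$ on $\mathbb{R}^\infty$. Strong consistency. For any map $h\colon\mathbb{R}^\infty\to\overline{\mathbb{R}}:=\mathbb{R}\cup\{-\infty,+\infty\}$, $h^*$ denotes a minimal measurable cover: a measurable map $h^*\colon\mathbb{R}^\infty\to\overline{\mathbb{R}}$ with $h^*\geqslant h$ and such that every measurable $g\colon\mathbb{R}^\infty\to\overline{\mathbb{R}}$ with $g\geqslant h$ satisfies $g\geqslant h^*$ $P^\infty$-almost surely; it always exists and is unique up to $P^\infty$-null sets. The estimator is strongly consistent if $\big|\hat{\underline{\mathrm{E}}}_n(f)-\underline{\mathrm{E}}^{\mathscr{P}}(f)\big|^*\to0$ $P^\infty$-almost surely as $n\to+\infty$, where $|h|^*$ is the minimal measurable cover of $|h|$. *)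

(* Defs.v *)
From HB Require Import structures.
From mathcomp Require Import all_boot all_order all_algebra.
From mathcomp Require Import all_classical all_reals all_analysis.
From mathcomp Require Import measurable_realfun.

Set Implicit Arguments.
Unset Strict Implicit.
Unset Printing Implicit Defensive.

Import Order.TTheory GRing.Theory Num.Theory.
Import numFieldNormedType.Exports.

Local Open Scope classical_set_scope.
Local Open Scope ring_scope.

Definition borelType (K : numFieldType) (V : normedModType K) :=
  g_sigma_algebraType (@open V).

(* Differentiability is Fréchet differentiability.  In finite dimension,
   pointwise continuity of p |-> 'd g p (for each v) is the same as its
   continuity for the operator norm.  On an open U the values of g outside U
   are irrelevant. *)
Definition continuously_differentiable_on (K : numFieldType)
    (V W : normedModType K) (U : set V) (g : V -> W) : Prop :=
  (forall p, U p -> differentiable g p) /\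
  (forall v p, U p -> {for p, continuous (fun q : V => 'd g q v)}).

Definition cylinders (R : realType) : set (set (nat -> R)) :=
  [set C | exists (k : nat) (A : set (measurableTypeR R)),
             measurable A /\ C = [set w | A (w k)]].

(* R^\infty with the product sigma-field.  The k-th coordinate projection
   (k = 0, 1, 2, ...) of w is w k. *)
Definition Rinf (R : realType) := g_sigma_algebraType (@cylinders R).

(* The finite-dimensional rectangles form a pi-system generating the product
   sigma-field, so this determines Pinf uniquely. *)
Definition is_product_probability (R : realType)
    (P : probability (measurableTypeR R) R)
    (Pinf : probability (Rinf R) R) : Prop :=
  forall (n : nat) (A : nat -> set (measurableTypeR R)),
    (forall k, measurable (A k)) ->
    Pinf [set w : Rinf R | forall k, (k < n)%N -> A k (w k)] =
      (\prod_(k < n) P (A k))%E.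

Definition is_minimal_measurable_cover (R : realType) (d : measure_display)
    (Omega : measurableType d) (Q : probability Omega R)
    (h hs : Omega -> \bar R) : Prop :=
  [/\ measurable_fun setT hs,
      (forall w, h w <= hs w)%E &
      forall g : Omega -> \bar R, measurable_fun setT g ->
        (forall w, h w <= g w)%E -> {ae Q, forall w, (hs w <= g w)%E}].

Definition lower_expectation (R : realType) (I : Type) (T : set I)
    (Pt : I -> probability (measurableTypeR R) R) (f : R -> R) : \bar R :=
  ereal_inf [set ('E_(Pt t)[f])%E | t in T].

(* Only n >= 1 is meaningful; for n = 0 the value is a constant, which has no
   bearing on the limit as n tends to infinity. *)
Definition estimator (R : realType) (I : Type) (T : set I)
    (ft : I -> R -> R) (n : nat) (w : Rinf R) : \bar R :=
  ereal_inf [set ((n%:R)^-1 * \sum_(k < n) ft t (w k))%:E | t in T].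

(* Minimal measurable covers are unique up to null sets, so the choice of hs
   is immaterial. *)
Definition strongly_consistent (R : realType)
    (Pinf : probability (Rinf R) R)
    (En : nat -> Rinf R -> \bar R) (e : \bar R) : Prop :=
  exists hs : nat -> Rinf R -> \bar R,
    (forall n, is_minimal_measurable_cover Pinf
                 (fun w => `|En n w - e|%E) (hs n)) /\
    {ae Pinf, forall w, hs n w @[n --> \oo] --> 0%E}.

(* Main.v *)
Require Import Defs.
From HB Require Import structures.
From mathcomp Require Import all_boot all_order all_algebra.
From mathcomp Require Import all_classical all_reals all_analysis.
From mathcomp Require Import measurable_realfun.

Set Implicit Arguments.
Unset Strict Implicit.
Unset Printing Implicit Defensive.

Import Order.TTheory GRing.Theory Num.Theory.
Import numFieldNormedType.Exports.

Local Open Scope classical_set_scope.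
Local Open Scope ring_scope.

(* The class {f_t} is a Glivenko-Cantelli class for lower deviations.  Given
   c < e := inf_t E f_t, dominated convergence (with the integrable envelope
   sup_t |f_t|) yields around each t a ball on which the infimum of the f_u
   still has expectation > c; finitely many such balls cover T, so by the strong
   law for these finitely many infima all empirical means are eventually >= c.
   The upper bound is the strong law for a single near-optimal t.  Measurability
   comes from replacing infima over T by infima over a dense sequence.

   The strong law is needed only as: E g < 0 implies that the partial sums of
   g(X_k) are a.s. bounded above.  Let M_n be the maximum of 0 and the first n
   partial sums, and B the event that M_n is unbounded.  B is shift-invariant,
   so the integral over B of M_{n+1} - M_n o shift is >= 0; the integrand equals
   max(- M_n o shift, g(X_0)) and tends to g(X_0) on B.  As B = shift^{-1} B is
   independent of X_0, the limit gives E g * P(B) >= 0, hence P(B) = 0. *)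

(** * The coordinate sequence, its shift and the product measure *)

Definition shift (R : realType) (w : Rinf R) : Rinf R := fun k => w k.+1.

(** Finite prefixes of measurable sides, the form in which [is_product_probability] prescribes
    values; the prefix of length 0 is the whole space. *)
Definition rectangles (R : realType) : set (set (Rinf R)) :=
  [set C | exists (n : nat) (A : nat -> set (measurableTypeR R)),
     (forall k, measurable (A k)) /\
     C = [set w | forall k, (k < n)%N -> A k (w k)]].

Lemma measurable_coord (R : realType) (k : nat) :
  measurable_fun setT (fun w : Rinf R => w k : measurableTypeR R).
Proof.
move=> _ A mA; rewrite setTI; apply: sub_sigma_algebra.
by exists k, A; split.
Qed.

Lemma measurable_fun_Rinf (R : realType) d (X : measurableType d)
    (phi : X -> Rinf R) :
  (forall k, measurable_fun setT (fun x => phi x k : measurableTypeR R)) ->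
  measurable_fun setT phi.
Proof.
move=> mphi; apply: (@measurability _ _ X (Rinf R) setT phi (@cylinders R) erefl).
move=> _ [_ [k [A [mA ->]]] <-].
exact: (mphi k measurableT A mA).
Qed.

Lemma measurable_shift (R : realType) : measurable_fun setT (@shift R).
Proof. by apply: measurable_fun_Rinf => k; exact: measurable_coord. Qed.

Lemma measurable_rectangle (R : realType) (C : set (Rinf R)) :
  rectangles C -> measurable C.
Proof.
move=> [n [A [mA ->]]].
rewrite (_ : mkset _ =
  \bigcap_(k in [set k | (k < n)%N]) ((fun w : Rinf R => w k) @^-1` A k)) //.
apply: bigcap_measurableType => k _; rewrite -[X in measurable X]setTI.
exact: measurable_coord.
Qed.

Lemma rectangles_generate (R : realType) :
  @measurable _ (Rinf R) = <<s @rectangles R >>.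
Proof.
apply/seteqP; split; last first.
  apply: smallest_sub; first exact: sigma_algebra_measurable.
  exact: measurable_rectangle.
apply: smallest_sub; first exact: smallest_sigma_algebra.
move=> _ [k [A [mA ->]]]; apply: sub_sigma_algebra.
exists k.+1, (fun j => if j == k then A else setT); split.
  by move=> j; case: ifP.
apply/seteqP; split => w /=; first by move=> Aw j _; case: eqP => // ->.
by move=> /(_ k (leqnn _)); rewrite eqxx.
Qed.

Lemma rectangles_setI (R : realType) : setI_closed (@rectangles R).
Proof.
move=> _ _ [n [A [mA ->]]] [p [B [mB ->]]].
exists (maxn n p), (fun k => (if (k < n)%N then A k else setT) `&`
                             (if (k < p)%N then B k else setT)); split.
  by move=> k; apply: measurableI; case: ifP.
apply/seteqP; split => w /= => [[wA wB] k _|wAB].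
  by split; case: ifP => // kn; [exact: wA|exact: wB].
split => k kn.
  by have := wAB k (leq_trans kn (leq_maxl _ _)); rewrite kn => -[].
by have := wAB k (leq_trans kn (leq_maxr _ _)); rewrite kn => -[_].
Qed.

Lemma Rinf_measure_unique (R : realType)
    (m1 m2 : {measure set (Rinf R) -> \bar R}) :
  (m1 setT < +oo)%E -> (forall C, rectangles C -> m1 C = m2 C) ->
  forall C, measurable C -> m1 C = m2 C.
Proof.
move=> m1T m12; apply: (@measure_unique _ _ _ (@rectangles R) (fun=> setT)) => //.
- exact: rectangles_generate.
- exact: rectangles_setI.
- move=> _; exists 0%N, (fun=> setT); split => //.
  by apply/seteqP; split.
- by rewrite bigcup_const//; exists 0%N.
Qed.

(** For fixed [A], both sides are finite measures in [B], so it suffices to compare them on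
    rectangles. There, putting [A] in front of the sides produces a rectangle one coordinate longer.
    This is independence of the first coordinate from the shifted sequence, together with invariance
    of [Pinf] under the shift. *)
Lemma product_probability_shift (R : realType)
    (P : probability (measurableTypeR R) R) (Pinf : probability (Rinf R) R) :
  is_product_probability P Pinf ->
  forall (A : set (measurableTypeR R)) (B : set (Rinf R)),
    measurable A -> measurable B ->
    Pinf [set w | A (w 0%N) /\ B (shift w)] = (P A * Pinf B)%E.
Proof.
move=> hP A B mA mB.
have mA0 : measurable [set w : Rinf R | A (w 0%N)].
  by rewrite -[X in measurable X]setTI; exact: measurable_coord.
(* [mscale] takes a nonnegative real factor, so the finite value [P A] is repackaged as one. *)
pose k : {nonneg R} := NngNum (fine_ge0 (measure_ge0 P A)).
have PA : (k%:num%:E = P A)%E by rewrite /= fineK// fin_num_measure.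
suff : pushforward (mrestr Pinf mA0) (@shift R) B = mscale k Pinf B.
  rewrite /mscale PA => <-; rewrite /pushforward /mrestr.
  by congr (Pinf _); apply/seteqP; split => w /= [].
apply: Rinf_measure_unique mB => [|ms|ms C [n [D [mD ->]]]].
- exact: measurable_shift.
- apply: le_lt_trans (ltry 1%R).
  rewrite /= /pushforward /mrestr preimage_setT setTI.
  exact: probability_le1.
- rewrite /= /mscale PA /pushforward /mrestr /=. rewrite (hP n D mD).
  pose E i := if i is j.+1 then D j else A.
  transitivity (Pinf [set w | forall k, (k < n.+1)%N -> E k (w k)]).
    congr (Pinf _); apply/seteqP; split => w /=.
      by move=> [Dw Aw] [|i] //; exact: Dw.
    by move=> Ew; split; [move=> i ni; exact: (Ew i.+1)|exact: (Ew 0%N)].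
  by rewrite hP => [|[]]; rewrite ?big_ord_recl.
Qed.

(** The pair [(w 0%N, shift w)] has law [P \x Pinf], by uniqueness of the product measure; Tonelli
    then separates [h] from the indicator of [B]. *)
Lemma ge0_integral_coord0_shift (R : realType)
    (P : probability (measurableTypeR R) R) (Pinf : probability (Rinf R) R)
    (h : measurableTypeR R -> \bar R) (B : set (Rinf R)) :
  is_product_probability P Pinf -> measurable B ->
  measurable_fun setT h -> (forall x, 0 <= h x)%E ->
  (\int[Pinf]_(w in @shift R @^-1` B) h (w 0%N) = (\int[P]_x h x) * Pinf B)%E.
Proof.
move=> hP mB mh h0.
pose phi (w : Rinf R) : measurableTypeR R * Rinf R := (w 0%N, shift w).
have mphi : measurable_fun setT phi.
  by apply/measurable_fun_pairP; split; [exact: measurable_coord|exact: measurable_shift].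
have mB' : measurable ([set: measurableTypeR R] `*` B) by exact: measurableX.
have mh1 : measurable_fun setT (h \o fst : measurableTypeR R * Rinf R -> \bar R).
  exact: measurableT_comp.
transitivity (\int[pushforward Pinf phi]_(z in setT `*` B) h z.1)%E.
  rewrite ge0_integral_pushforward//; last exact: measurable_funTS.
  by congr integral; apply/seteqP; split => w //= [].
transitivity (\int[P \x Pinf]_(z in setT `*` B) h z.1)%E.
  apply: eq_measure_integral => //.
  move=> A mA _; symmetry; apply: product_measure_unique => //.
  by move=> A1 A2 mA1 mA2; rewrite -product_probability_shift.
rewrite integral_mkcond /=.
rewrite fubini_tonelli1//=; last 2 first.
- by apply/(measurable_restrictT _ mB'); exact: measurable_funTS.
- by move=> z; apply: erestrict_ge0.
rewrite /fubini_F/= -ge0_integralZr//.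
apply: eq_integral => x _.
rewrite -integral_cst// [RHS]integral_mkcond.
apply: eq_integral => y _.
by rewrite !patchE in_setX in_setT.
Qed.

Lemma integrable_coord0 (R : realType)
    (P : probability (measurableTypeR R) R) (Pinf : probability (Rinf R) R)
    (g : measurableTypeR R -> R) :
  is_product_probability P Pinf -> P.-integrable setT (EFin \o g) ->
  Pinf.-integrable setT (fun w : Rinf R => (g (w 0%N))%:E).
Proof.
move=> hP /integrableP[mg gfin]; apply/integrableP; split.
  exact: (measurableT_comp mg (@measurable_coord R 0)).
have mag : measurable_fun setT (fun x => `|(g x)%:E|%E) by exact: measurableT_comp.
have := ge0_integral_coord0_shift hP (@measurableT _ (Rinf R)) mag (fun=> abse_ge0 _).
by rewrite preimage_setT => ->; rewrite probability_setT mule1.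
Qed.

(** Positive and negative parts are treated separately; integrability makes the recombination by
    [muleBl] legitimate. *)
Lemma integral_coord0_shift (R : realType)
    (P : probability (measurableTypeR R) R) (Pinf : probability (Rinf R) R)
    (g : measurableTypeR R -> R) (B : set (Rinf R)) :
  is_product_probability P Pinf -> measurable B ->
  P.-integrable setT (EFin \o g) ->
  (\int[Pinf]_(w in @shift R @^-1` B) (g (w 0%N))%:E =
   (\int[P]_x (g x)%:E) * Pinf B)%E.
Proof.
move=> hP mB intg; have mg := measurable_int _ intg.
rewrite [LHS]integralE [in RHS]integralE.
have fp := ge0_integral_coord0_shift hP mB (measurable_funepos mg) (fun=> funepos_ge0 _ _).
have fn := ge0_integral_coord0_shift hP mB (measurable_funeneg mg) (fun=> funeneg_ge0 _ _).
have fp' : (\int[Pinf]_(w in @shift R @^-1` B) (EFin \o g)^\+ (w 0%N) =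
    \int[Pinf]_(w in @shift R @^-1` B) (fun w : Rinf R => (g (w 0%N))%:E)^\+ w)%E.
  by apply: eq_integral => w _; rewrite !funeposE.
have fn' : (\int[Pinf]_(w in @shift R @^-1` B) (EFin \o g)^\- (w 0%N) =
    \int[Pinf]_(w in @shift R @^-1` B) (fun w : Rinf R => (g (w 0%N))%:E)^\- w)%E.
  by apply: eq_integral => w _; rewrite !funenegE.
rewrite muleBl.
- rewrite -[X in (X - _)%E = _]fp' -[X in (_ - X)%E = _]fn'.
  by rewrite fp fn.
- by rewrite fin_num_measure.
- by rewrite fin_num_adde_defl// fin_numN integrable_neg_fin_num.
Qed.


(** The shift preserves [Pinf]: this is [product_probability_shift] with [setT] as the condition on
    the first coordinate. *)
Lemma integral_shift (R : realType)
    (P : probability (measurableTypeR R) R) (Pinf : probability (Rinf R) R)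
    (B : set (Rinf R)) (h : Rinf R -> \bar R) :
  is_product_probability P Pinf -> measurable B ->
  measurable_fun setT h -> (forall w, 0 <= h w)%E ->
  (\int[Pinf]_(w in @shift R @^-1` B) h (shift w) = \int[Pinf]_(w in B) h w)%E.
Proof.
move=> hP mB mh h0.
rewrite -[LHS](ge0_integral_pushforward (@measurable_shift R))//; last first.
  exact: measurable_funTS.
apply: eq_measure_integral => //; first exact: measurable_shift.
move=> ms A mA _; rewrite /= /pushforward -[RHS]mul1e -(probability_setT P).
rewrite -(product_probability_shift hP)//.
by congr (Pinf _); apply/seteqP; split => w //= [].
Qed.

(** * Running maxima of partial sums and a one-sided strong law *)

(* The maximum of 0 and the first n partial sums of g (w k), computed from the
   left end so that it unfolds along the shift. *)
Fixpoint maxsum (R : realType) (g : R -> R) (n : nat) (w : Rinf R) : R :=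
  if n is p.+1 then Num.max 0 (g (w 0%N) + maxsum g p (shift w)) else 0.

Lemma maxsum_ge0 (R : realType) (g : R -> R) (n : nat) (w : Rinf R) :
  0 <= maxsum g n w.
Proof. by case: n => //= n; rewrite le_max lexx. Qed.

Lemma maxsum_leS (R : realType) (g : R -> R) (n : nat) (w : Rinf R) :
  maxsum g n w <= maxsum g n.+1 w.
Proof.
elim: n w => [|n IHn] w; first exact: maxsum_ge0.
by rewrite /= ge_max le_max lexx /= le_max lerD2l IHn orbT.
Qed.

Lemma maxsum_homo (R : realType) (g : R -> R) (w : Rinf R) :
  {homo (maxsum g)^~ w : n p / (n <= p)%N >-> n <= p}.
Proof.
apply: homo_leq => [x|y x z|n]; [exact: lexx|exact: le_trans|].
exact: maxsum_leS.
Qed.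

Lemma sum_le_maxsum (R : realType) (g : R -> R) (n : nat) (w : Rinf R) :
  \sum_(k < n) g (w k) <= maxsum g n w.
Proof.
elim: n w => [|n IHn] w; first by rewrite big_ord0.
by rewrite big_ord_recl /= le_max lerD2l (IHn (shift w)) orbT.
Qed.

Lemma measurable_maxsum (R : realType) (g : measurableTypeR R -> R) (n : nat) :
  measurable_fun setT g -> measurable_fun setT (maxsum g n).
Proof.
move=> mg; elim: n => [|n IHn]; first exact: measurable_cst.
apply: measurable_maxr; first exact: measurable_cst.
apply: measurable_funD.
  exact: (measurableT_comp mg (@measurable_coord R 0)).
exact: measurableT_comp IHn (@measurable_shift R).
Qed.

(** The second claim follows from the first by shift invariance, and it feeds the induction:
    [maxsum g n.+1 w] is a maximum with 0, hence at most the absolute value of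
    [g (w 0%N) + maxsum g n (shift w)]. *)
Lemma integrable_maxsum (R : realType)
    (P : probability (measurableTypeR R) R) (Pinf : probability (Rinf R) R)
    (g : measurableTypeR R -> R) (n : nat) :
  is_product_probability P Pinf -> P.-integrable setT (EFin \o g) ->
  Pinf.-integrable setT (EFin \o maxsum g n) /\
  Pinf.-integrable setT (fun w => (maxsum g n (shift w))%:E).
Proof.
move=> hP intg; have /measurable_EFinP mg := measurable_int _ intg.
have mM k : measurable_fun setT (EFin \o maxsum g k).
  by apply/measurable_EFinP; exact: measurable_maxsum.
have mMs k : measurable_fun setT (fun w => (maxsum g k (shift w))%:E).
  exact: measurableT_comp (mM k) (@measurable_shift R).
have shifted k : Pinf.-integrable setT (EFin \o maxsum g k) ->
    Pinf.-integrable setT (fun w => (maxsum g k (shift w))%:E).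
  move=> /integrableP[_ fin]; apply/integrableP; split => //.
  apply: le_lt_trans fin.
  have mabs : measurable_fun setT (fun w => `|(maxsum g k w)%:E|%E).
    by apply: measurableT_comp => //; exact: mM.
  have := integral_shift hP measurableT mabs (fun=> abse_ge0 _).
  by rewrite preimage_setT => ->.
suff intM : Pinf.-integrable setT (EFin \o maxsum g n) by split; [|exact: shifted].
elim: n => [|n /shifted IHn]; first exact: integrable0.
have intgM : Pinf.-integrable setT
    (fun w : Rinf R => (g (w 0%N))%:E + (maxsum g n (shift w))%:E)%E.
  by apply: integrableD => //; exact: integrable_coord0 hP intg.
apply: le_integrable intgM => // w _.
rewrite -EFinD !abse_EFin lee_fin /= ger0_norm ?le_max ?lexx//.
by rewrite ge_max normr_ge0 ler_norm.
Qed.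

(** Thresholds range over the naturals, which makes the event a countable intersection of countable
    unions. *)
Definition unbounded_sums (R : realType) (g : R -> R) : set (Rinf R) :=
  [set w | forall C : nat, exists n, C%:R < maxsum g n w].

Lemma measurable_unbounded_sums (R : realType) (g : measurableTypeR R -> R) :
  measurable_fun setT g -> measurable (unbounded_sums g).
Proof.
move=> mg.
have -> : unbounded_sums g = \bigcap_C \bigcup_n (maxsum g n @^-1` `]C%:R, +oo[).
  apply/seteqP; split => w /= wB C.
    move=> _; have [n Cn] := wB C; exists n => //=.
    by rewrite in_itv/= andbT.
  by have [n _ /=] := wB C I; rewrite in_itv/= andbT => Cn; exists n.
apply: bigcapT_measurable => C; apply: bigcupT_measurable => n.
rewrite -[X in measurable X]setTI; apply: measurable_maxsum => //.
Qed.

(** Passing from [shift w] to [w] adds the single number [g (w 0%N)] before the maximum with 0 is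
    taken, and this cannot affect unboundedness. *)
Lemma unbounded_sums_shift (R : realType) (g : R -> R) :
  @shift R @^-1` unbounded_sums g = unbounded_sums g.
Proof.
apply/seteqP; split => w /= wB C.
  have [n Cn] := wB (Num.bound `|C%:R - g (w 0%N)|).
  exists n.+1; rewrite /= lt_max -ltrBlDl.
  apply/orP; right; apply: le_lt_trans Cn.
  by rewrite (le_trans (ler_norm _))// ltW// archi_boundP.
have [n Cn] := wB (C + Num.bound `|g (w 0%N)|)%N.
exists n; have := lt_le_trans Cn (maxsum_leS g n w).
(* The threshold is nonnegative, so the maximum exceeding it is not the one attained at 0. *)
rewrite /= lt_max ltNge ler0n /= natrD addrC => CM.
rewrite -(ltrD2l (g (w 0%N))); apply: le_lt_trans CM; rewrite lerD2r.
by rewrite (le_trans (ler_norm _))// ltW// archi_boundP.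
Qed.

Lemma unbounded_sums_null (R : realType)
    (P : probability (measurableTypeR R) R) (Pinf : probability (Rinf R) R)
    (g : measurableTypeR R -> R) :
  is_product_probability P Pinf -> P.-integrable setT (EFin \o g) ->
  (\int[P]_x (g x)%:E < 0)%E ->
  Pinf (unbounded_sums g) = 0%E.
Proof.
move=> hP intg g0; have /measurable_EFinP mg := measurable_int _ intg.
set B := unbounded_sums g.
have mB : measurable B by exact: measurable_unbounded_sums.
have sB : @shift R @^-1` B = B by exact: unbounded_sums_shift.
have intM n := integrable_maxsum n hP intg.
have intg0 := integrable_coord0 hP intg.
pose d n (w : Rinf R) : \bar R :=
  ((maxsum g n.+1 w)%:E - (maxsum g n (shift w))%:E)%E.
have intd n : Pinf.-integrable setT (d n).
  by apply: integrableB => //; [exact: (intM n.+1).1|exact: (intM n).2].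
have dE n w : d n w = (Num.max (- maxsum g n (shift w)) (g (w 0%N)))%:E.
  by rewrite /d -EFinB /= addr_maxl sub0r addrK.
(* Invariance of [Pinf] and of [B] turns the integral of [maxsum g n (shift w)] over [B] into that
   of [maxsum g n w], and the running maxima increase with [n]. *)
have d_ge0 n : (0 <= \int[Pinf]_(w in B) d n w)%E.
  rewrite integralB//; last 2 first.
  - by apply: integrableS (intM n.+1).1.
  - by apply: integrableS (intM n).2.
  have mM := measurable_int _ (intM n).1.
  have M0 w : (0 <= (EFin \o maxsum g n) w)%E by rewrite lee_fin maxsum_ge0.
  have := integral_shift hP mB mM M0; rewrite sB => /= ->.
  rewrite sube_ge0.
    apply: ge0_le_integral => //.
    - by move=> w _; rewrite lee_fin maxsum_ge0.
    - by apply: measurable_funTS; exact: measurable_int (intM n).1.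
    - by apply: measurable_funTS; exact: measurable_int (intM n.+1).1.
    - by move=> w _; rewrite lee_fin maxsum_leS.
  by apply/orP; left; apply: integrable_fin_num => //; apply: integrableS (intM n).1.
have dcvg : (\int[Pinf]_(w in B) d n w @[n --> \oo] -->
              \int[Pinf]_(w in B) (g (w 0%N))%:E)%E.
  have [] := @dominated_convergence _ _ _ Pinf B mB d
    (fun w => (g (w 0%N))%:E) (fun w => `|(g (w 0%N))%:E|%E) => //.
  - by move=> n; apply: measurable_funTS; exact: measurable_int (intd n).
  - by apply: measurable_funTS; exact: measurable_int intg0.
  (* On [B] the shifted sequence also has unbounded maxima. Once they exceed the absolute value of
     [g (w 0%N)], the maximum in [dE] equals [g (w 0%N)], so the sequence is eventually constant. *)
  - apply: aeW => w wB; have : (@shift R @^-1` B) w by rewrite sB.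
    move=> /(_ (Num.bound `|g (w 0%N)|)) [N NM].
    apply: cvg_near_cst; exists N => // n /= Nn; rewrite dE.
    congr EFin; apply/max_idPr; rewrite lerNl.
    rewrite (le_trans (ler_norm _))// normrN ltW//.
    apply: lt_le_trans (maxsum_homo g (shift w) Nn).
    by apply: lt_trans NM; rewrite archi_boundP.
  - by apply: integrableS (integrable_abse intg0).
  (* The maximum in [dE] is at least [g (w 0%N)] and, its other entry being nonpositive, at most the
     absolute value of [g (w 0%N)]. *)
  - apply: aeW => w n _; rewrite dE !abse_EFin lee_fin.
    have M0 := maxsum_ge0 g n (shift w); rewrite ler_norml ge_max; apply/and3P; split.
    + by rewrite le_max (lerNl _ (g _)) -(normrN (g _)) ler_norm orbT.
    + by rewrite (le_trans (y := 0)) ?oppr_le0.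
    + exact: ler_norm.
have : (0 <= \int[Pinf]_(w in B) (g (w 0%N))%:E)%E.
  rewrite -(cvg_lim _ dcvg)//; apply: lime_ge; first by apply/cvg_ex; eexists; exact: dcvg.
  exact: nearW.
rewrite -sB (integral_coord0_shift hP)// sB => pos.
apply/eqP; rewrite eq_le measure_ge0 andbT leNgt; apply/negP => B0.
by move: pos; rewrite leNgt mule_lt0_gt0.
Qed.

Lemma ae_sums_bounded_above (R : realType)
    (P : probability (measurableTypeR R) R) (Pinf : probability (Rinf R) R)
    (g : measurableTypeR R -> R) :
  is_product_probability P Pinf -> P.-integrable setT (EFin \o g) ->
  (\int[P]_x (g x)%:E < 0)%E ->
  {ae Pinf, forall w : Rinf R, exists C : R, forall n, \sum_(k < n) g (w k) <= C}.
Proof.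
move=> hP intg g0; have /measurable_EFinP mg := measurable_int _ intg.
exists (unbounded_sums g); split.
- exact: measurable_unbounded_sums.
- exact: unbounded_sums_null hP intg g0.
- move=> w /= wC C; apply: contrapT => wn; apply: wC; exists C%:R => n.
  apply: le_trans (sum_le_maxsum g n w) _; rewrite leNgt; apply/negP => Cn.
  by apply: wn; exists n.
Qed.

(** * Finite covers, dense sequences and measurable infima *)

(** The radius may depend on the centre, as it does for the brackets chosen later; constant radii
    give finite nets. *)
Lemma compact_seq_cover (R : realType) (V : normedModType R) (T : set V)
    (r : V -> R) :
  compact T -> (forall t, T t -> 0 < r t) ->
  exists s : seq V, (forall t, t \in s -> T t) /\
    forall t, T t -> exists2 t', t' \in s & ball t' (r t') t.
Proof.
rewrite compact_cover => cT r0.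
have [t _|t Tt|D DT TD] := cT V T (fun t => ball t (r t)).
- exact: ball_open.
- by exists t => //; apply: ballxx; exact: r0.
- exists (finmap.enum_fset D); split => [t /DT /set_mem //|t /TD [t' Dt' tt']].
  by exists t'.
Qed.

(** Serves both the almost-everywhere filter and the filter of large [n]. *)
Lemma filter_forall_seq (I : eqType) (X : Type) (H : set_system X)
    {FH : Filter H} (A : I -> X -> Prop) (s : seq I) :
  (forall i, i \in s -> \forall x \near H, A i x) ->
  \forall x \near H, forall i, i \in s -> A i x.
Proof.
elim: s => [|i s IHs] HA; first exact: nearW.
have Ai : \forall x \near H, A i x by apply: HA; rewrite mem_head.
have As : \forall x \near H, forall j, j \in s -> A j x.
  by apply: IHs => j js; apply: HA; rewrite in_cons js orbT.
apply: filterS2 Ai As => x Aix Asx j; rewrite in_cons => /orP[/eqP -> //|].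
exact: Asx.
Qed.

(** The sequence enumerates the union over [k] of finite nets of mesh 1/(k+1). *)
Lemma compact_dense_seq (R : realType) (V : normedModType R) (T : set V) :
  compact T -> T !=set0 ->
  exists s : nat -> V, (forall n, T (s n)) /\
    forall U : set V, open U -> T `&` U !=set0 -> exists n, U (s n).
Proof.
move=> cT [t0 Tt0].
have net (k : nat) : exists s : seq V, (forall t, t \in s -> T t) /\
    forall t, T t -> exists2 t', t' \in s & ball t' k.+1%:R^-1 t.
  by apply: (compact_seq_cover (r := fun=> k.+1%:R^-1)).
have [D D_net] := choice net.
(* The code of a pair [(k, i)] is sent to the [i]-th point of the [k]-th net; [t0] fills invalid
   codes and indices past the end. *)
pose s n := if unpickle n is Some (k, i) then nth t0 (D k) i else t0.
exists s; split => [n|U oU [t [Tt Ut]]].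
  rewrite /s; case: unpickle => [[k i]|] //.
  have [iD|Di] := ltnP i (size (D k)); last by rewrite nth_default.
  by apply: (D_net k).1; exact: mem_nth.
have /nbhs_ballP[e /= e0 eU] : nbhs t U by exact: open_nbhs_nbhs.
have [k ke] : exists k : nat, k.+1%:R^-1 < e.
  exists (Num.bound e^-1); rewrite invf_plt ?posrE//.
  apply: lt_trans (archi_boundP _) _; first by rewrite invr_ge0 ltW.
  by rewrite ltr_nat.
have [t' t'D tt'] := (D_net k).2 t Tt.
exists (pickle (k, index t' (D k))); rewrite /s pickleK nth_index//.
apply: eU; apply: ball_sym; apply: le_ball tt'; exact: ltW.
Qed.

(** By continuity in the parameter, the infimum is already reached along a dense sequence. The open
    set [U] is a ball for the brackets and the whole space for the envelope and the estimator. *)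
Lemma measurable_fun_compact_inf (R : realType) (V : normedModType R)
    (T U : set V) d (X : measurableType d) (F : V -> X -> R) :
  compact T -> open U -> T `&` U !=set0 ->
  (forall t, T t -> measurable_fun setT (F t)) ->
  (forall x t, T t -> {for t, continuous (F^~ x)}) ->
  measurable_fun setT (fun x => ereal_inf [set (F t x)%:E | t in T `&` U]).
Proof.
move=> cT oU [t1 [Tt1 Ut1]] mF cF.
have [s [sT sU]] := compact_dense_seq cT (ex_intro _ _ Tt1).
(* Dense points outside [U] are replaced by [t1], so that no value outside [T] and [U] enters the
   infimum. *)
pose u n := if `[< U (s n) >] then s n else t1.
have uTU n : (T `&` U) (u n) by rewrite /u; case: asboolP.
have -> : (fun x => ereal_inf [set (F t x)%:E | t in T `&` U]) =
    (fun x => einfs (fun n => (F (u n) x)%:E) 0%N).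
  apply/funext => x; apply/eqP; rewrite eq_le; apply/andP; split.
    apply/ereal_infP => _ [n _ <-]; apply: ereal_inf_lbound.
    by exists (u n).
  apply/ereal_infP => _ [t [Tt Ut] <-]; apply/lee_addgt0Pr => e e0.
  (* Intersecting with [U] ensures that the dense point found near [t] is one that [u] keeps. *)
  have : nbhs t ((F^~ x) @^-1` ball (F t x) e `&` U).
    apply: filterI; last exact: open_nbhs_nbhs.
    by apply: cF => //; exact: nbhsx_ballx.
  rewrite nbhsE => -[W [oW Wt] WU].
  have [n Wn] := sU W oW (ex_intro _ t (conj Tt Wt)).
  have [Fn Un] := WU _ Wn.
  apply: ge_ereal_inf; exists (F (u n) x)%:E; first by exists n.
  rewrite /u asboolT// -EFinD lee_fin; move: Fn.
  rewrite /ball/= => /ltW; rewrite ler_distlC => /andP[_].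
  done.
apply: measurable_fun_einfs => n; apply/measurable_EFinP.
by apply: mF; exact: (uTU n).1.
Qed.

(** * Lower brackets: infima over small parameter balls *)

(* [inf] is 0 on sets that are not bounded below; compactness of T excludes
   this case in every use. *)
Definition lower_bracket (R : realType) (V : normedModType R) (T : set V)
    (X : Type) (F : V -> X -> R) (t : V) (r : R) (x : X) : R :=
  inf [set F u x | u in T `&` ball t r].

Lemma compact_image_bounded (R : realType) (V : normedModType R) (T : set V)
    (phi : V -> R) :
  compact T -> (forall t, T t -> {for t, continuous phi}) ->
  exists M : R, forall t, T t -> `|phi t| <= M.
Proof.
move=> cT cphi.
have wphi : {within T, continuous phi}.
  by apply: continuous_in_subspaceT => t /set_mem; exact: cphi.
have [M [_ /(_ (M + 1)) MT]] := compact_bounded (continuous_compact wphi cT).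
exists (M + 1) => t Tt; apply: MT; first by rewrite ltrDl.
by exists t.
Qed.

Lemma lower_bracket_le (R : realType) (V : normedModType R) (T : set V)
    (X : Type) (F : V -> X -> R) (t u : V) (r : R) (x : X) :
  compact T -> (forall t, T t -> {for t, continuous (F^~ x)}) ->
  T u -> ball t r u -> lower_bracket T F t r x <= F u x.
Proof.
move=> cT cF Tu tu; apply: ge_inf; last by exists u.
have [M FM] := compact_image_bounded cT cF.
exists (- M) => _ [v [Tv _] <-].
by have := FM v Tv; rewrite ler_norml => /andP[].
Qed.

(** The set under the infimum is nonempty and, by compactness, bounded below, so the real infimum
    agrees with the extended one. *)
Lemma measurable_lower_bracket (R : realType) (V : normedModType R)
    (T : set V) d (X : measurableType d) (F : V -> X -> R) (t : V) (r : R) :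
  compact T -> T t -> 0 < r ->
  (forall t, T t -> measurable_fun setT (F t)) ->
  (forall x t, T t -> {for t, continuous (F^~ x)}) ->
  measurable_fun setT (lower_bracket T F t r).
Proof.
move=> cT Tt r0 mF cF.
have TU : T `&` ball t r !=set0 by exists t; split => //; exact: ballxx.
apply/measurable_EFinP.
have -> : EFin \o lower_bracket T F t r =
    fun x => ereal_inf [set (F u x)%:E | u in T `&` ball t r].
  apply/funext => x; rewrite /= -[in RHS](image_comp (F^~ x) EFin).
  rewrite ereal_inf_EFin//; last by have [u Tu] := TU; exists (F u x), u.
  have [M FM] := compact_image_bounded cT (cF x).
  exists (- M) => _ [v [Tv _] <-].
  by have := FM v Tv; rewrite ler_norml => /andP[].
by apply: measurable_fun_compact_inf => //; exact: ball_open.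
Qed.

(** For the fixed [x], continuity at [t] keeps all values on a small ball within [e] of [F t x],
    hence their infimum too. *)
Lemma cvg_lower_bracket (R : realType) (V : normedModType R) (T : set V)
    (X : Type) (F : V -> X -> R) (t : V) (x : X) :
  compact T -> T t -> (forall t, T t -> {for t, continuous (F^~ x)}) ->
  lower_bracket T F t n.+1%:R^-1 x @[n --> \oo] --> F t x.
Proof.
move=> cT Tt cF; apply/cvgrPdist_le => e e0.
have : \forall u \near t, `|F t x - F u x| <= e.
  by have /cvgrPdist_le/(_ _ e0) := cF t Tt.
move=> /nbhs_ballP[r /= r0 rF].
have : \forall n \near \oo, n.+1%:R^-1 < r.
  exact: (near_infty_natSinv_lt (PosNum r0)).
apply: filterS => n nr.
have n0 : (0 : R) < n.+1%:R^-1 by rewrite invr_gt0.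
have bF : lower_bracket T F t n.+1%:R^-1 x <= F t x.
  by apply: lower_bracket_le => //; exact: ballxx.
rewrite ger0_norm ?subr_ge0// lerBlDl -lerBlDr.
apply: lb_le_inf; first by exists (F t x), t => //; split => //; exact: ballxx.
move=> _ [u [_ tu] <-]; rewrite lerBlDr -lerBlDl.
apply: le_trans (ler_norm _) _; apply: rF; apply: le_ball tu; exact: ltW.
Qed.

(** * Integrability under the envelope *)

(** What remains to be shown is measurability; the supremum is rewritten as minus an infimum of
    continuous functions of the parameter. *)
Lemma integrable_envelope (R : realType) d (X : measurableType d)
    (P : probability X R) (V : normedModType R) (T : set V) (F : V -> X -> R) :
  compact T -> T !=set0 ->
  (forall t, T t -> measurable_fun setT (F t)) ->
  (forall x t, T t -> {for t, continuous (F^~ x)}) ->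
  (\int[P]_x ereal_sup [set `|F t x|%:E | t in T] < +oo)%E ->
  P.-integrable setT (fun x => ereal_sup [set `|F t x|%:E | t in T]).
Proof.
move=> cT [t0 Tt0] mF cF fin.
have G0 x : (0 <= ereal_sup [set `|F t x|%:E | t in T])%E.
  by apply: le_ereal_sup_tmp; exists `|F t0 x|%:E; [exists t0|rewrite lee_fin].
apply/integrableP; split; last first.
  by under eq_integral => x _ do rewrite gee0_abs//.
have -> : (fun x => ereal_sup [set `|F t x|%:E | t in T]) =
    (fun x => - ereal_inf [set (- `|F t x|)%:E | t in T `&` setT])%E.
  apply/funext => x; rewrite ereal_supEN setIT; congr (- ereal_inf _)%E.
  by rewrite image_comp.
apply: measurableT_comp => //.
apply: (@measurable_fun_compact_inf _ _ T setT _ _ (fun t x => - `|F t x|)) => //.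
- exact: openT.
- by exists t0.
- by move=> t Tt; do 2 apply: measurableT_comp => //; exact: mF.
- move=> x t Tt; apply: continuousN; apply: continuous_comp; first exact: cF.
  exact: norm_continuous.
Qed.

Lemma integrable_envelope_member (R : realType) d (X : measurableType d)
    (P : probability X R) (V : normedModType R) (T : set V) (F : V -> X -> R)
    (t : V) :
  T t -> measurable_fun setT (F t) ->
  P.-integrable setT (fun x => ereal_sup [set `|F t x|%:E | t in T]) ->
  P.-integrable setT (EFin \o F t).
Proof.
move=> Tt mF; apply: le_integrable => // [|x _]; first exact/measurable_EFinP.
rewrite abse_EFin; apply: le_trans (lee_abs _).
by apply: ereal_sup_ubound; exists t.
Qed.

(** Dominated convergence along the radii 1/(n+1): the bracket expectations tend to that of [F t],
    so one of them exceeds [c]. *)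
Lemma exists_lower_bracket (R : realType) d (X : measurableType d)
    (P : probability X R) (V : normedModType R) (T : set V) (F : V -> X -> R)
    (t : V) (c : R) :
  compact T -> T t ->
  (forall t, T t -> measurable_fun setT (F t)) ->
  (forall x t, T t -> {for t, continuous (F^~ x)}) ->
  P.-integrable setT (fun x => ereal_sup [set `|F t x|%:E | t in T]) ->
  (c%:E < \int[P]_x (F t x)%:E)%E ->
  exists r : R, [/\ 0 < r, P.-integrable setT (EFin \o lower_bracket T F t r) &
    (c%:E < \int[P]_x (lower_bracket T F t r x)%:E)%E].
Proof.
move=> cT Tt mF cF iG cFt.
have r0 n : (0 : R) < n.+1%:R^-1 by rewrite invr_gt0.
have ml n : measurable_fun setT (EFin \o lower_bracket T F t n.+1%:R^-1).
  by apply/measurable_EFinP; exact: measurable_lower_bracket.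
have lG n x : (`|(lower_bracket T F t n.+1%:R^-1 x)%:E| <=
    ereal_sup [set `|F t x|%:E | t in T])%E.
  set G := ereal_sup _.
  have FG u : T u -> (`|F u x|%:E <= G)%E.
    by move=> Tu; apply: ereal_sup_ubound; exists u.
  have [M FM] := compact_image_bounded cT (cF x).
  (* Compactness makes the envelope finite at every [x], so the bracket can be compared with it in
     the reals. *)
  have Gfin : G \is a fin_num.
    rewrite ge0_fin_numE; last by apply: le_trans (FG _ Tt); rewrite lee_fin.
    apply: le_lt_trans (ltry M); apply/ereal_supP => _ [u Tu <-].
    by rewrite lee_fin FM.
  rewrite abse_EFin -(fineK Gfin) lee_fin ler_norml; apply/andP; split.
    apply: lb_le_inf; first by exists (F t x), t => //; split => //; exact: ballxx.
    move=> _ [u [Tu _] <-]; have := FG u Tu.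
    by rewrite -(fineK Gfin) lee_fin ler_norml => /andP[].
  apply: (@le_trans _ _ (F t x)).
    by apply: lower_bracket_le => //; [exact: cF|exact: ballxx].
  by have := FG t Tt; rewrite -(fineK Gfin) lee_fin => /(le_trans (ler_norm _)).
have il n : P.-integrable setT (EFin \o lower_bracket T F t n.+1%:R^-1).
  apply: le_integrable iG => // x _.
  by apply: le_trans (lG n x) _; exact: lee_abs.
have [|||_ _ lF] := @dominated_convergence _ _ _ P setT measurableT
  (fun n => EFin \o lower_bracket T F t n.+1%:R^-1) (EFin \o F t) _ ml _ _ iG.
- by apply/measurable_EFinP; exact: mF.
- apply: aeW => x _; apply: cvg_EFin; first exact: nearW.
  by apply: cvg_lower_bracket => //; exact: cF.
- by apply: aeW => x n _; exact: lG.
have : \forall n \near \oo,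
    (c%:E < \int[P]_x (lower_bracket T F t n.+1%:R^-1 x)%:E)%E.
  apply: (lF [set y | (c%:E < y)%E]); apply: open_nbhs_nbhs.
  by split => //; exact: open_ereal_gt_ereal.
by move=> [N _ /(_ N (leqnn _)) NF]; exists N.+1%:R^-1.
Qed.

(** * Almost sure bounds on empirical means *)

(** With [b] strictly between [a] and the mean of [g], the function [b - g] has negative mean, so
    its partial sums stay below some [C]. The slack [(b - a) * n] absorbs [C] once [n] is at least
    [C / (b - a)]. *)
Lemma ae_near_mean_ge (R : realType)
    (P : probability (measurableTypeR R) R) (Pinf : probability (Rinf R) R)
    (g : measurableTypeR R -> R) (a : R) :
  is_product_probability P Pinf -> P.-integrable setT (EFin \o g) ->
  (a%:E < \int[P]_x (g x)%:E)%E ->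
  {ae Pinf, forall w : Rinf R, \forall n \near \oo,
     a <= n%:R^-1 * \sum_(k < n) g (w k)}.
Proof.
move=> hP ig ag.
set e := (\int[P]_x (g x)%:E)%E in ag *.
have efin : e \is a fin_num := integrable_fin_num measurableT ig.
pose b := (a + fine e) / 2.
have ae : a < fine e by rewrite -lte_fin fineK.
have ab : a < b by rewrite midf_lt.
have be : b < fine e by rewrite midf_lt.
have ib : P.-integrable setT (EFin \o cst b) by exact: finite_measure_integrable_cst.
have ih : P.-integrable setT (EFin \o (fun x => b - g x)).
  exact: (integrableB measurableT ib ig).
have h0 : (\int[P]_x (b - g x)%:E < 0)%E.
  under eq_integral => x _ do rewrite EFinB.
  rewrite (integralB measurableT ib ig).
  have -> : (\int[P]_x (EFin \o cst b) x = b%:E)%E.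
    rewrite (integral_cst P measurableT b%:E).
    by rewrite [X in (_ * X)%E](@probability_setT _ _ _ P) mule1.
  by rewrite -[X in (_ - X)%E]/e -(fineK efin) -EFinB lte_fin subr_lt0.
have := ae_sums_bounded_above hP ih h0; apply: filterS => w [C SC].
near=> n.
have n0 : (0 < n)%N by near: n; exact: nbhs_infty_gt.
rewrite mulrC ler_pdivlMr ?ltr0n//.
have := SC n; rewrite sumrB sumr_const card_ord -(mulr_natr b) lerBlDr -lerBlDl => SCn.
apply: le_trans SCn; rewrite lerBrDr -lerBrDl -mulrBl mulrC -ler_pdivrMr ?subr_gt0//.
near: n; exact: nbhs_infty_ger.
Unshelve. all: by end_near. Qed.

Lemma ae_near_mean_le (R : realType)
    (P : probability (measurableTypeR R) R) (Pinf : probability (Rinf R) R)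
    (g : measurableTypeR R -> R) (a : R) :
  is_product_probability P Pinf -> P.-integrable setT (EFin \o g) ->
  (\int[P]_x (g x)%:E < a%:E)%E ->
  {ae Pinf, forall w : Rinf R, \forall n \near \oo,
     n%:R^-1 * \sum_(k < n) g (w k) <= a}.
Proof.
move=> hP ig ga.
have ig' : P.-integrable setT (EFin \o (\- g)) by exact: integrableN ig.
have ga' : ((- a)%:E < \int[P]_x (- g x)%:E)%E.
  under eq_integral => x _ do rewrite EFinN.
  by rewrite integralN ?EFinN ?lteN2// fin_num_adde_defl// fin_numN integrable_neg_fin_num.
have := ae_near_mean_ge hP ig' ga'; apply: filterS => w; apply: filterS => n.
by rewrite sumrN mulrN lerN2.
Qed.

(** Every [F t] dominates one of finitely many brackets, so the means of those brackets bound all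
    empirical means at once. *)
Lemma ae_near_means_ge (R : realType)
    (P : probability (measurableTypeR R) R) (Pinf : probability (Rinf R) R)
    (V : normedModType R) (T : set V) (F : V -> measurableTypeR R -> R)
    (c e : R) :
  is_product_probability P Pinf -> compact T ->
  (forall t, T t -> measurable_fun setT (F t)) ->
  (forall x t, T t -> {for t, continuous (F^~ x)}) ->
  P.-integrable setT (fun x => ereal_sup [set `|F t x|%:E | t in T]) ->
  c < e -> (forall t, T t -> (e%:E <= \int[P]_x (F t x)%:E)%E) ->
  {ae Pinf, forall w : Rinf R, \forall n \near \oo,
     forall t, T t -> c <= n%:R^-1 * \sum_(k < n) F t (w k)}.
Proof.
move=> hP cT mF cF iG ce eF.
(* Stated for all [t], with a dummy radius outside [T], so that [choice] yields a total function. *)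
have rP (t : V) : exists r : R, T t ->
    [/\ 0 < r, P.-integrable setT (EFin \o lower_bracket T F t r) &
       (c%:E < \int[P]_x (lower_bracket T F t r x)%:E)%E].
  have [Tt|nTt] := pselect (T t); last by exists 0.
  have cFt : (c%:E < \int[P]_x (F t x)%:E)%E.
    by apply: lt_le_trans (eF t Tt); rewrite lte_fin.
  by have [r rP] := exists_lower_bracket cT Tt mF cF iG cFt; exists r.
have [r r_spec] := choice rP.
have [|D [DT TD]] := compact_seq_cover (r := r) cT.
  by move=> t Tt; have [] := r_spec t Tt.
pose good t : set (Rinf R) := [set w : Rinf R | \forall n \near \oo,
  c <= n%:R^-1 * \sum_(k < n) lower_bracket T F t (r t) (w k)].
(* Since [D] is finite, the quantifier over its members can be moved inside both the almost sure
   event and the eventual statement. *)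
have : {ae Pinf, forall w, forall t, t \in D -> good t w}.
  apply: filter_forall_seq => t Dt.
  by have [_ il cl] := r_spec t (DT t Dt); exact: ae_near_mean_ge hP il cl.
apply: filterS => w gw.
have : \forall n \near \oo, forall t, t \in D ->
    c <= n%:R^-1 * \sum_(k < n) lower_bracket T F t (r t) (w k).
  exact: filter_forall_seq gw.
apply: filterS => n cn t Tt; have [t' Dt' tt'] := TD t Tt.
apply: le_trans (cn t' Dt') _; rewrite ler_wpM2l ?invr_ge0//.
by apply: ler_sum => k _; apply: lower_bracket_le => //; exact: cF.
Qed.

(** * Measurability of the estimator and strong consistency *)

Lemma measurable_estimator (R : realType) (V : normedModType R) (T : set V)
    (F : V -> measurableTypeR R -> R) (n : nat) :
  compact T -> T !=set0 ->
  (forall t, T t -> measurable_fun setT (F t)) ->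
  (forall x t, T t -> {for t, continuous (F^~ x)}) ->
  measurable_fun setT (estimator T F n).
Proof.
move=> cT [t0 Tt0] mF cF.
pose M t (w : Rinf R) := n%:R^-1 * \sum_(k < n) F t (w k).
have -> : estimator T F n =
    (fun w => ereal_inf [set (M t w)%:E | t in T `&` setT]).
  by apply/funext => w; rewrite setIT.
apply: measurable_fun_compact_inf => //; first exact: openT.
- by exists t0.
- move=> t Tt; apply: measurable_funM => //; apply: measurable_sum => k.
  exact: (measurableT_comp (mF t Tt) (@measurable_coord R k)).
- move=> w t Tt; apply: cvgMl_tmp.
  elim: (n) => [|k IHk].
    by rewrite big_ord0; under eq_fun do rewrite big_ord0; exact: cvg_cst.
  rewrite big_ord_recr; under eq_fun do rewrite big_ord_recr.
  by apply: cvgD => //; exact: cF.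
Qed.

(** The case [eps = 1] makes [u n] eventually finite, after which the convergence is one of
    reals. *)
Lemma cvg_dist0_squeeze (R : realType) (u : nat -> \bar R) (e : R) :
  (forall eps : R, 0 < eps -> \forall n \near \oo,
     ((e - eps)%:E <= u n <= (e + eps)%:E)%E) ->
  (`|u n - e%:E| @[n --> \oo] --> 0)%E.
Proof.
move=> ue; apply/fine_cvgP; split.
  have := ue 1 ltr01; apply: filterS => n /andP[lo hi].
  rewrite abse_fin_num fin_numB/= andbT fin_real//.
  by rewrite (lt_le_trans (ltNyr _) lo) (le_lt_trans hi (ltry _)).
apply/cvgrPdist_le => eps eps0; have := ue eps eps0; apply: filterS => n.
rewrite sub0r normrN /=; case: (u n) => [x| |] /=; rewrite ?leye_eq ?leeNy_eq//; last first.
  by rewrite andbF.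
by rewrite !lee_fin normr_id ler_distl.
Qed.

(** The form with a compact set of parameters in a normed space and continuity in the parameter at
    each of its points. *)
Theorem strongly_consistent_estimator (R : realType)
    (P : probability (measurableTypeR R) R) (Pinf : probability (Rinf R) R)
    (V : normedModType R) (T : set V) (F : V -> measurableTypeR R -> R) :
  is_product_probability P Pinf -> compact T -> T !=set0 ->
  (forall t, T t -> measurable_fun setT (F t)) ->
  (forall x t, T t -> {for t, continuous (F^~ x)}) ->
  (\int[P]_x ereal_sup [set `|F t x|%:E | t in T] < +oo)%E ->
  strongly_consistent Pinf (estimator T F)
    (ereal_inf [set \int[P]_x (F t x)%:E | t in T])%E.
Proof.
move=> hP cT T0 mF cF fin.
have iG := integrable_envelope cT T0 mF cF fin.
have iF t (Tt : T t) := integrable_envelope_member Tt (mF t Tt) iG.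
set G := (fun x => ereal_sup _) in iG.
set E := ereal_inf _.
(* The infimum lies between minus the integral of the envelope and the integral of a single
   [F t0]. *)
have Efin : E \is a fin_num.
  have [t0 Tt0] := T0.
  have Gfin := integrable_fin_num measurableT iG.
  rewrite fin_real//; apply/andP; split.
    apply: (@lt_le_trans _ _ (- \int[P]_x G x)%E).
      by rewrite -(fineK Gfin) -EFinN ltNyr.
    apply/ereal_infP => _ [t Tt <-].
    rewrite leeNl; apply: le_trans (lee_abs _) _; rewrite abseN.
    apply: le_trans (le_abse_integral _ _ _) _ => //; first exact: measurable_int (iF t Tt).
    apply: ge0_le_integral => //.
    - by apply: measurableT_comp => //; exact: measurable_int (iF t Tt).
    - exact: measurable_int iG.
    - by move=> x _; apply: ereal_sup_ubound; exists t.
  apply: le_lt_trans (_ : \int[P]_x (F t0 x)%:E < +oo)%E.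
    by apply: ereal_inf_lbound; exists t0.
  exact: integrable_lty (iF t0 Tt0).
(* The distance is measurable, hence its own minimal cover. *)
exists (fun n w => `|estimator T F n w - E|%E); split.
  move=> n; split => [|//|g _ Eg]; last exact: aeW.
  apply: measurableT_comp => //; apply: emeasurable_funB => //.
  exact: measurable_estimator.
(* Tolerances 1/(j+1) keep the exceptional null sets countable in number, so that [ae_foralln] can
   combine them. *)
have lo (j : nat) : {ae Pinf, forall w : Rinf R, \forall n \near \oo,
    ((fine E - j.+1%:R^-1)%:E <= estimator T F n w)%E}.
  have ce : fine E - j.+1%:R^-1 < fine E by rewrite gtrBl invr_gt0.
  have eF t : T t -> ((fine E)%:E <= \int[P]_x (F t x)%:E)%E.
    by move=> Tt; rewrite fineK//; apply: ereal_inf_lbound; exists t.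
  have := ae_near_means_ge hP cT mF cF iG ce eF; apply: filterS => w.
  apply: filterS => n cn; apply/ereal_infP => _ [t Tt <-].
  by rewrite lee_fin cn.
have hi (j : nat) : {ae Pinf, forall w : Rinf R, \forall n \near \oo,
    (estimator T F n w <= (fine E + j.+1%:R^-1)%:E)%E}.
  have /ereal_inf_ltP[_ [t Tt <-] Ft] : (E < (fine E + j.+1%:R^-1)%:E)%E.
    by rewrite -[ltLHS]fineK// lte_fin ltrDl invr_gt0.
  have := ae_near_mean_le hP (iF t Tt) Ft; apply: filterS => w.
  apply: filterS => n cn; apply: ge_ereal_inf.
  by exists (n%:R^-1 * \sum_(k < n) F t (w k))%:E; [exists t|rewrite lee_fin].
move: (ae_foralln lo) (ae_foralln hi); apply: filterS2 => w low hiw.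
rewrite -(fineK Efin); apply: cvg_dist0_squeeze => eps eps0.
have [j _ /(_ j (leqnn _)) jeps] := near_infty_natSinv_lt (PosNum eps0).
apply: filterS2 (low j) (hiw j) => n lon hin; apply/andP; split.
  by apply: le_trans lon; rewrite lee_fin lerB// ltW.
by apply: le_trans hin _; rewrite lee_fin lerD2l ltW.
Qed.

(** * Continuously differentiable families with parameters in finite dimension *)

Theorem theorem14 (R : realType) (m : nat) (hm : (0 < m)%N)
  (T : set 'rV[R]_m) (hT0 : T !=set0) (hTc : compact T)
  (To : set 'rV[R]_m) (hTo : open To) (hTTo : T `<=` To)
  (P : probability (measurableTypeR R) R)
  (Pinf : probability (Rinf R) R) (hPinf : is_product_probability P Pinf)
  (Pt : 'rV[R]_m -> probability (measurableTypeR R) R)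
  (f : R -> R) (hf : measurable_fun [set: measurableTypeR R] f)
  (hfsup : (ereal_sup [set 'E_(Pt t)[fun x => `|f x|%R] | t in T] < +oo)%E)
  (ft : 'rV[R]_m -> R -> R)
  (hft : forall t, T t -> measurable_fun [set: measurableTypeR R] (ft t))
  (hEft : forall t, T t -> ('E_P[ft t] = 'E_(Pt t)[f])%E)
  (hEaft : forall t, T t ->
     ('E_P[fun x => `|ft t x|%R] = 'E_(Pt t)[fun x => `|f x|%R])%E)
  (fTo : R * 'rV[R]_m -> R)
  (hfTo_meas : measurable_fun
     ([set: R] `*` To : set (borelType (R * 'rV[R]_m)%type)) fTo)
  (hfTo : forall t, T t -> ft t = fun x => fTo (x, t))
  (hfTo_C1 : continuously_differentiable_on ([set: R] `*` To) fTo)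
  (hsup : (\int[P]_x ereal_sup [set `|ft t x|%:E | t in T] < +oo)%E) :
  strongly_consistent Pinf (estimator T ft) (lower_expectation T Pt f).
Proof.
(* Continuity is required in the ambient space at each point of [T], whereas [ft] is arbitrary off
   [T]. The sections of [fTo] agree with [ft] on [T] and are continuous there because [To] is an
   open neighbourhood of [T]. *)
pose F (t : 'rV[R]_m) (x : measurableTypeR R) : R := fTo (x, t).
have ftF t : T t -> ft t = F t by exact: hfTo.
have -> : estimator T ft = estimator T F.
  apply/funext => n; apply/funext => w; congr ereal_inf.
  by apply: eq_imagel => t Tt; rewrite ftF.
have -> : lower_expectation T Pt f =
    ereal_inf [set \int[P]_x (F t x)%:E | t in T]%E.
  congr ereal_inf; apply: eq_imagel => t Tt.
  by rewrite -hEft// ftF// unlock.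
apply: strongly_consistent_estimator => //.
- by move=> t Tt; rewrite -ftF//; exact: hft.
- move=> x t Tt.
  have /differentiable_continuous cf : differentiable fTo (x, t).
    by apply: hfTo_C1.1; split => //; exact: hTTo.
  apply: (@continuous_comp _ _ _ (pair x) fTo) => //.
  exact: (cvg_pair (cvg_cst x) (@cvg_id _ (nbhs t))).
- apply: le_lt_trans hsup; rewrite le_eqVlt; apply/orP; left; apply/eqP.
  apply: eq_integral => x _; congr ereal_sup.
  by apply: eq_imagel => t Tt; rewrite ftF.
Qed.
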